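(* $H_{\mathrm{even}}\cap(3000,5000]$ is contained in the five-element candidate set \[ \{3398,3518,4166,4502,4622\}. \]
   Context: 3-Higgs primes are defined recursively: $2$ is 3-Higgs; an odd prime $p$ is 3-Higgs if and only if every prime factor $q$ of $p-1$ is a 3-Higgs prime (necessarily $q<p$) and satisfies $v_q(p-1)\le 3$ (including $v_2(p-1)\le 3$), where $v_q$ is the $q$-adic valuation. $H$ is the set of integers $m\ge 1$ such that every prime factor of $2^m+1$ is 3-Higgs, and $H_{\mathrm{even}}=H\cap 2\mathbb{Z}$. *)

(* Defs.v *)
From mathcomp Require Import all_boot.

Set Implicit Arguments.
Unset Strict Implicit.
Unset Printing Implicit Defensive.

(* The recursive characterization is well founded (q < p), so its least
   solution is its only one; [higgs3_oddE] is the defining equivalence. *)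
Inductive higgs3 : nat -> Prop :=
| Higgs3_two : higgs3 2
| Higgs3_odd p :
    prime p -> odd p ->
    (forall q, prime q -> q %| p - 1 -> higgs3 q) ->
    (forall q, prime q -> q %| p - 1 -> logn q (p - 1) <= 3) ->
    higgs3 p.

Lemma higgs3_prime p : higgs3 p -> prime p.
Proof. by case. Qed.

Lemma higgs3_oddE p : prime p -> odd p ->
  higgs3 p <->
  (forall q, prime q -> q %| p - 1 -> higgs3 q /\ logn q (p - 1) <= 3).
Proof.
move=> p_pr p_odd; split=> [hp | hq].
  by case: hp p_odd => // r _ _ h1 h2 _ q q_pr q_dvd; split; [apply: h1 | apply: h2].
by apply: Higgs3_odd => // q q_pr q_dvd; have [] := hq q q_pr q_dvd.
Qed.

Definition H (m : nat) : Prop :=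
  1 <= m /\ forall p, prime p -> p %| 2 ^ m + 1 -> higgs3 p.

Definition H_even (m : nat) : Prop := H m /\ 2 %| m.

(* Main.v *)
Require Import Defs.
From mathcomp Require Import all_boot cyclic zify.
From Stdlib Require Import PArith NArith.

(** An even [m] is [4 * j], or [2 * k] with [k] odd. The first kind is never in
    [H]: [17 = 2 ^ 4 + 1] divides [2 ^ m + 1] when [j] is odd, and when [j] is
    even the order of [2] modulo any prime factor of [2 ^ m + 1] is divisible
    by [16]. For the second kind [2 ^ m + 1 = 4 ^ k + 1] is divisible by
    [4 ^ d + 1] for every [d] dividing [k]; so it suffices that the divisors [d]
    of [k] include one for which [4 ^ d + 1] has a prime factor that is not
    3-Higgs. Such a [d] is exhibited for each odd [k] between [1501] and [2499]
    outside the five exceptions, in one of two ways.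

    - [d] is itself a prime that is not 3-Higgs. The order of [2] modulo a prime
      factor [p] of [4 ^ d + 1] other than [5] is [4 * d], so [d] divides
      [p - 1] ([non_higgs_divisor]).
    - A factor [n] of [4 ^ d + 1] is given; the table lists them.

    The factors [n] were found by trial division and by elliptic curves, and
    have up to 35 digits. A prime [n] is seen not to be 3-Higgs from a chain
    [n = n_0, n_1, ..., n_t, q] of primes in which [n_(i+1)] divides [n_i - 1]
    and [q ^ 4] divides [n_t - 1]. Proving every [n_i] prime can be avoided:
    [higgs_free n] says that no prime factor of [n] is 3-Higgs, and this passes
    from [n_(i+1)] to [n_i] by the argument of Pocklington's criterion
    ([higgs_free_order]). If [a ^ (n - 1)] is [1] modulo [n], and
    [a ^ ((n - 1) / q) - 1] is prime to [n], then modulo each prime factor [p]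
    of [n] the order of [a], hence [p - 1], retains a prime factor [s] of [q],
    to the fourth power at least if [q ^ 4] divides [n - 1]. Thus a certificate
    for [n] is just a pair [(a, q)]. *)

(** * Numbers without 3-Higgs prime factors *)

(** For prime [n] this says that [n] is not 3-Higgs. *)
Definition higgs_free n := forall p, prime p -> p %| n -> ~ higgs3 p.

Lemma higgs3_factor p q : higgs3 p -> prime q -> q %| p - 1 ->
  higgs3 q /\ logn q (p - 1) <= 3.
Proof.
case=> [|r _ _ hq lq] q_pr q_dvd; last by split; [apply: hq | apply: lq].
by move: q_dvd q_pr; rewrite dvdn1 => /eqP->.
Qed.

Lemma expn_mod1_gcdn a i j p : 0 < i ->
  a ^ i = 1 %[mod p] -> a ^ j = 1 %[mod p] -> a ^ gcdn i j = 1 %[mod p].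
Proof.
move=> i_gt0 ai aj; have [u v def_u _] := egcdnP j i_gt0.
have pow1 b c : a ^ b = 1 %[mod p] -> a ^ (c * b) = 1 %[mod p].
  by move=> ab; rewrite mulnC expnM -modnXm ab modnXm exp1n.
by have := pow1 _ u ai; rewrite def_u expnD -modnMml pow1 // modnMml mul1n.
Qed.

(** The order of [a] modulo a prime factor [p] of [n] divides
    [g = gcdn e (p - 1)], and does not divide [e %/ q]. So some prime [s] has a
    higher exponent in [g] than in [e %/ q]: it divides [q], since [g] divides
    [e], and [p - 1], since [g] does. If [q ^ 4] divides [e], the exponent of
    [s] in [e %/ q] is at least [3], hence at least [4] in [g]. *)
Lemma higgs_free_order a e q n : 0 < e -> q %| e -> a ^ e = 1 %[mod n] ->
    (forall p, prime p -> p %| n -> a ^ (e %/ q) <> 1 %[mod p]) ->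
    higgs_free q \/ q ^ 4 %| e ->
  higgs_free n.
Proof.
move=> e_gt0 q_dvd_e ae1 a_neq1 q_bad p p_pr p_dvd_n p_higgs.
have q_gt0 : 0 < q := dvdn_gt0 e_gt0 q_dvd_e.
have ae1p : a ^ e = 1 %[mod p] by rewrite -(modn_dvdm _ p_dvd_n) ae1 modn_dvdm.
have p1_gt0 : 0 < p - 1 by rewrite subn_gt0 prime_gt1.
have ap1p : a ^ (p - 1) = 1 %[mod p].
  rewrite subn1 -(totient_prime p_pr); apply: Euler_exp_totient.
  rewrite coprime_sym prime_coprime //; apply/negP=> p_dvd_a.
  move: ae1p; rewrite (eqP (dvdn_trans p_dvd_a (dvdn_exp e_gt0 (dvdnn a)))).
  by rewrite modn_small // prime_gt1.
set g := gcdn e (p - 1); have g_gt0 : 0 < g by rewrite gcdn_gt0 e_gt0.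
suff /dvdnP[c def_eq] : g %| e %/ q.
  apply: (a_neq1 p p_pr p_dvd_n).
  by rewrite def_eq mulnC expnM -modnXm expn_mod1_gcdn // modnXm exp1n.
have eq_gt0 : 0 < e %/ q by rewrite divn_gt0 // dvdn_leq.
apply/dvdn_partP=> // s; rewrite mem_primes => /and3P[s_pr _ s_dvd_g].
rewrite p_part pfactor_dvdn // leqNgt logn_div //; apply/negP=> lt_log.
have [s_higgs log_le3] : higgs3 s /\ logn s (p - 1) <= 3.
  exact: higgs3_factor (dvdn_trans s_dvd_g (dvdn_gcdr _ _)).
have log_ge : logn s g <= logn s e by apply: dvdn_leq_log (dvdn_gcdl _ _).
have log_gp : logn s g <= logn s (p - 1) by apply: dvdn_leq_log (dvdn_gcdr _ _).
have log_q : 0 < logn s q.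
  by rewrite lt0n; apply: contraL lt_log => /eqP->; rewrite subn0 -leqNgt.
have s_dvd_q : s %| q.
  by move: log_q; rewrite logn_gt0 mem_primes => /and3P[].
case: q_bad => [/(_ s s_pr s_dvd_q) // | /(dvdn_leq_log s e_gt0)].
rewrite lognX => q4; move: lt_log q4 log_q (leq_trans log_gp log_le3).
by move: (logn s e) (logn s q) (logn s g) => x y z; clear; lia.
Qed.

Lemma dvdn_not_H m n : 1 < n -> n %| 2 ^ m + 1 -> higgs_free n -> ~ H m.
Proof.
move=> n_gt1 n_dvd n_free [_ m_higgs].
apply: (n_free (pdiv n)); rewrite ?pdiv_prime ?pdiv_dvd //.
by apply: m_higgs; rewrite ?pdiv_prime // (dvdn_trans (pdiv_dvd n)).
Qed.

(** * Multiples of 4 and divisors of odd exponents *)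

Lemma sqr_mod_succ x : x ^ 2 = 1 %[mod x + 1].
Proof.
case: x => [|x]; first by rewrite modn1.
by rewrite (_ : x.+1 ^ 2 = x * (x.+1 + 1) + 1) ?modnMDl //; lia.
Qed.

Lemma dvdn_succ_exp_odd x c : odd c -> x + 1 %| x ^ c + 1.
Proof.
move=> c_odd; rewrite -(odd_double_half c) c_odd add1n expnS -mul2n expnM.
rewrite /dvdn -modnDml -modnMmr -modnXm sqr_mod_succ modnXm exp1n modnMmr muln1.
by rewrite modnDml modnn.
Qed.

Lemma dvdn_succ_4exp d k : d %| k -> odd k -> 4 ^ d + 1 %| 4 ^ k + 1.
Proof.
case/dvdnP=> c ->; rewrite oddM mulnC expnM => /andP[c_odd _].
exact: dvdn_succ_exp_odd.
Qed.

Lemma dvdn4_not_H m : 0 < m -> 4 %| m -> ~ H m.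
Proof.
move=> m_gt0 /dvdnP[j def_m]; have [j_odd | j_even] := boolP (odd j).
  apply: (@dvdn_not_H m 17) => //.
    by rewrite def_m mulnC expnM; apply: (@dvdn_succ_exp_odd 16).
  move=> p p_pr; rewrite dvdn_prime2 // => /eqP-> higgs17.
  by have [] := higgs3_factor 17 2 higgs17 (isT : prime 2) isT.
apply: (@dvdn_not_H m (2 ^ m + 1)) => //.
  by rewrite addn1 ltnS expn_gt0.
apply: (@higgs_free_order 2 (2 * m) 2);
  [by rewrite muln_gt0 | exact: dvdn_mulr | | |].
- by rewrite mulnC expnM sqr_mod_succ.
- move=> p p_pr p_dvd; rewrite mulKn // => m1.
  have : p %| 2 by move: p_dvd; rewrite /dvdn -modnDml m1 modnDml.
  rewrite dvdn_prime2 // => /eqP p2; move: p_dvd.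
  by rewrite p2 dvdn2 addn1 oddS oddX /= eqn0Ngt m_gt0.
- right; rewrite def_m -{1}[j]odd_double_half (negPf j_even) -mul2n.
  by apply/dvdnP; exists j./2; lia.
Qed.

(** Then [2 * k] is outside [H] for every odd multiple [k] of [d]. *)
Definition obstruction d :=
  exists n, [/\ 1 < n, n %| 4 ^ d + 1 & higgs_free n].

(** Modulo a prime factor of [n = (4 ^ r + 1) %/ 5] the order of [2] divides
    [4 * r] but not [4], as [2 ^ 4 - 1] only has the prime factors [3], which
    never divides [4 ^ r + 1], and [5], which by assumption divides it once. *)
Lemma non_higgs_divisor r : higgs_free r -> 1 < r -> odd r ->
  (4 ^ r + 1) %% 25 != 0 -> obstruction r.
Proof.
move=> r_free r_gt1 r_odd not25.
have /dvdnP[n def_n] : 5 %| 4 ^ r + 1 by apply: (@dvdn_succ_exp_odd 4).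
have n_dvd : n %| 4 ^ r + 1 by rewrite def_n dvdn_mulr.
exists n; split=> //.
  have : 4 ^ 2 <= 4 ^ r by rewrite leq_exp2l.
  by rewrite -(leq_add2r 1) def_n; clear; lia.
apply: (@higgs_free_order 2 (4 * r) r);
  [by rewrite muln_gt0; lia | exact: dvdn_mull | | | by left].
  rewrite (expnM 2 4) -[2 ^ 4]/(4 ^ 2) expnAC.
  by rewrite -(modn_dvdm _ n_dvd) sqr_mod_succ modn_dvdm.
move=> p p_pr p_dvd; rewrite mulnK ?(ltnW r_gt1) // => /eqP.
rewrite eqn_mod_dvd // (_ : 2 ^ 4 - 1 = 3 * 5) // Euclid_dvdM //.
have p_dvd4 := dvdn_trans p_dvd n_dvd.
rewrite !dvdn_prime2 // => /orP[]/eqP p_eq.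
  by move: p_dvd4; rewrite p_eq /dvdn -modnDml -modnXm exp1n.
case/negP: not25; change (5 * 5 %| 4 ^ r + 1); rewrite def_n dvdn_pmul2r //.
by rewrite -p_eq.
Qed.

(** * Certificates over binary integers *)

Lemma to_natD x y : N.to_nat (x + y) = N.to_nat x + N.to_nat y.
Proof. exact: N2Nat.inj_add. Qed.

Lemma to_natM x y : N.to_nat (x * y) = N.to_nat x * N.to_nat y.
Proof. exact: N2Nat.inj_mul. Qed.

Lemma to_natB x y : N.to_nat (x - y) = N.to_nat x - N.to_nat y.
Proof. exact: N2Nat.inj_sub. Qed.

Lemma to_nat_eq x y : (N.to_nat x == N.to_nat y) = (x =? y)%num.
Proof. by apply/eqP/N.eqb_spec=> [/N2Nat.inj|->]. Qed.

Lemma to_nat_gt1 x : (1 <? x)%num -> 1 < N.to_nat x.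
Proof. by move/N.ltb_spec0; clear; lia. Qed.

Lemma to_nat_divmod x y : N.to_nat (x / y) = N.to_nat x %/ N.to_nat y /\
  N.to_nat (x mod y) = N.to_nat x %% N.to_nat y.
Proof.
have [-> | y_neq0] := N.eq_dec y 0; first by case: x.
have y_gt0 : 0 < N.to_nat y by rewrite lt0n (to_nat_eq y 0); apply/N.eqb_spec.
have lt_mod : N.to_nat (x mod y) < N.to_nat y.
  by have := N.mod_lt x y y_neq0; move: (x mod y)%num => r; clear; lia.
have -> : N.to_nat x = N.to_nat (x / y) * N.to_nat y + N.to_nat (x mod y).
  by rewrite -to_natM -to_natD N.mul_comm -N.div_mod'.
by rewrite divnMDl // modnMDl divn_small // addn0 modn_small.
Qed.

Lemma to_nat_div x y : N.to_nat (x / y) = N.to_nat x %/ N.to_nat y.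
Proof. by case: (to_nat_divmod x y). Qed.

Lemma to_nat_mod x y : N.to_nat (x mod y) = N.to_nat x %% N.to_nat y.
Proof. by case: (to_nat_divmod x y). Qed.

Fixpoint powmod_pos (a n : N) (e : positive) : N :=
  match e with
  | xH => a mod n
  | xO e' => let r := powmod_pos a n e' in (r * r) mod n
  | xI e' => let r := powmod_pos a n e' in (a * ((r * r) mod n)) mod n
  end%num.

Definition powmod (a n e : N) : N :=
  if e is Npos e' then powmod_pos a n e' else (1 mod n)%num.

Lemma powmodE a n e :
  N.to_nat (powmod a n e) = N.to_nat a ^ N.to_nat e %% N.to_nat n.
Proof.
case: e => [|e]; first by rewrite /= to_nat_mod.
rewrite /=; elim: e => [e IHe | e IHe |] /=; rewrite to_nat_mod ?expn1 //.
- rewrite to_natM to_nat_mod to_natM IHe Pos2Nat.inj_xI expnS.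
  by rewrite modnMm modnMmr -expnD addnn -mul2n.
- by rewrite to_natM IHe Pos2Nat.inj_xO modnMm -expnD addnn -mul2n.
Qed.

Lemma gcd1_ndvdn x y p : (N.gcd x y =? 1)%num -> prime p ->
  p %| N.to_nat x -> p %| N.to_nat y -> False.
Proof.
move=> /N.eqb_spec gcd1 p_pr /dvdnP[u def_x] /dvdnP[v def_y].
have div_of z w : N.to_nat z = w * p -> N.divide (N.of_nat p) z.
  move=> def_z; exists (N.of_nat w); apply: N2Nat.inj.
  by rewrite to_natM !Nat2N.id.
have := N.gcd_greatest _ _ _ (div_of x u def_x) (div_of y v def_y).
rewrite gcd1 => /N.divide_1_r p1; move: p_pr.
by rewrite -[p]Nat2N.id p1.
Qed.

(** The hypotheses of [higgs_free_order] for [e = n - 1]; [known] holds the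
    [q] already known to be [higgs_free]. *)
Definition certifies (known : seq N) (cert : N * N * N) : bool :=
  let: (n, a, q) := cert in
  [&& (1 <? n), (n - 1) mod q =? 0, powmod a n (n - 1) =? 1,
      N.gcd (powmod a n ((n - 1) / q) - 1) n =? 1
    & has (N.eqb q) known || ((n - 1) mod (q * q * q * q) =? 0)]%num.

Lemma certifiesP known n a q :
    (forall x, has (N.eqb x) known -> higgs_free (N.to_nat x)) ->
  certifies known (n, a, q) -> higgs_free (N.to_nat n).
Proof.
move=> known_free /and5P[/to_nat_gt1 n_gt1 q_dvd ae1 gcd1 q_bad].
move: q_dvd ae1 q_bad.
rewrite -!to_nat_eq !to_nat_mod powmodE !to_natB => q_dvd ae1 q_bad.
apply: (@higgs_free_order (N.to_nat a) (N.to_nat n - 1) (N.to_nat q)).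
- by rewrite subn_gt0.
- exact: q_dvd.
- by rewrite (eqP ae1) [RHS]modn_small.
- move=> p p_pr p_dvd a1; apply: (gcd1_ndvdn _ _ p gcd1 p_pr) => //.
  rewrite to_natB powmodE to_nat_div to_natB.
  set r := _ %% _; have r1 : r = 1 %[mod p] by rewrite modn_dvdm.
  (* The truncated difference [r - 1] is a true one, as [r = 0] would give
     [0 = 1] modulo [p]. *)
  rewrite -eqn_mod_dvd ?r1 // lt0n; apply: contra_eq_neq r1 => ->.
  by rewrite mod0n modn_small // prime_gt1.
- case/orP: q_bad => [/known_free | q4]; [by left | right].
  by move: q4; rewrite !to_natM !expnS expn0 muln1 !mulnA.
Qed.

Fixpoint all_certified (known : seq N) (certs : seq (N * N * N)) : bool :=
  if certs is cert :: certs' then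
    certifies known cert && all_certified (cert.1.1 :: known) certs'
  else true.

Lemma all_certifiedP known certs :
    (forall x, has (N.eqb x) known -> higgs_free (N.to_nat x)) ->
    all_certified known certs ->
  forall x, has (N.eqb x) [seq cert.1.1 | cert <- certs] ->
    higgs_free (N.to_nat x).
Proof.
elim: certs known => //= [[[n a] q] certs IHcerts] known known_free.
case/andP=> cert_n certs_ok x /=.
have n_free : higgs_free (N.to_nat n) := certifiesP _ _ _ _ known_free cert_n.
case/orP=> [/N.eqb_spec-> // | ]; apply: IHcerts certs_ok x.
by move=> y /= /orP[/N.eqb_spec-> // | /known_free].
Qed.

(** * The tables *)

(** Entries [(n, a, q)], in increasing order of [n]: since [q < n], an entry
    that relies on [q] comes after the one for [q]. *)
Definition certificates : seq (N * N * N) := [::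
  (17, 3, 2); (97, 5, 2); (103, 2, 17); (113, 3, 2); (137, 2, 17); (163, 2, 3);
  (193, 5, 2); (227, 2, 113); (239, 2, 17); (241, 7, 2); (257, 3, 2);
  (307, 2, 17); (337, 5, 2); (353, 3, 2); (389, 2, 97); (401, 3, 2);
  (409, 2, 17); (433, 5, 2); (443, 2, 17); (449, 3, 2); (479, 2, 239);
  (487, 2, 3); (577, 5, 2); (593, 3, 2); (613, 2, 17); (619, 2, 103);
  (641, 3, 2); (647, 2, 17); (653, 2, 163); (673, 5, 2); (769, 7, 2);
  (773, 2, 193); (811, 3, 3); (823, 2, 137); (881, 3, 2); (929, 3, 2);
  (953, 2, 17); (1031, 2, 103); (1097, 2, 137); (1153, 5, 2); (1229, 2, 307);
  (1249, 7, 2); (1283, 2, 641); (1361, 3, 2); (1531, 2, 17); (1543, 2, 257);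
  (1553, 3, 2); (1583, 2, 113); (1601, 3, 2); (1621, 2, 3); (1637, 2, 409);
  (1667, 2, 17); (1697, 3, 2); (1733, 2, 433); (1747, 2, 97); (1777, 5, 2);
  (1783, 2, 3); (1871, 2, 17); (1873, 5, 2); (1889, 3, 2); (1907, 2, 953);
  (1913, 2, 239); (1931, 2, 193); (1949, 2, 487); (1973, 2, 17); (2017, 5, 2);
  (2063, 2, 1031); (2081, 3, 2); (2113, 5, 2); (2129, 3, 2); (2143, 2, 17);
  (2161, 7, 2); (2267, 2, 103); (2269, 2, 3); (2273, 3, 2); (2309, 2, 577);
  (2347, 2, 17); (2381, 2, 17); (2411, 2, 241); (2417, 3, 2); (2459, 2, 1229);
  (2467, 2, 137); (2473, 2, 103); (2477, 2, 619); (3761, 3, 2); (4421, 2, 17);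
  (5101, 2, 17); (5233, 5, 2); (6257, 3, 2); (8101, 3, 3); (8369, 3, 2);
  (8609, 3, 2); (9929, 3, 17); (10993, 5, 2); (11057, 3, 2); (14753, 3, 2);
  (16673, 3, 2); (21149, 3, 17); (23509, 2, 653); (25367, 2, 1153);
  (25409, 3, 2); (25793, 3, 2); (25873, 5, 2); (25889, 3, 2); (25969, 7, 2);
  (26417, 3, 2); (26513, 3, 2); (28753, 5, 2); (29137, 5, 2); (35537, 3, 2);
  (37361, 3, 2); (39409, 7, 2); (41521, 11, 2); (42569, 3, 17);
  (48341, 2, 2417); (53633, 3, 2); (54001, 7, 2); (58337, 3, 2); (65393, 3, 2);
  (65633, 3, 2); (65831, 2, 227); (69109, 2, 443); (71777, 3, 2); (75217, 5, 2);
  (78049, 7, 2); (79841, 3, 2); (83761, 7, 2); (88657, 5, 2); (103837, 3, 17);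
  (111121, 7, 2); (115153, 5, 2); (121789, 3, 17); (126913, 5, 2);
  (128203, 2, 929); (131267, 2, 65633); (152203, 2, 25367); (157649, 3, 2);
  (243973, 7, 3); (246241, 11, 2); (257189, 3, 113); (266081, 3, 2);
  (288817, 5, 2); (308641, 13, 2); (387397, 3, 17); (390193, 5, 2);
  (393713, 3, 2); (426061, 3, 3); (454921, 3, 17); (493169, 3, 2);
  (500177, 3, 2); (525313, 5, 2); (539761, 7, 2); (585889, 7, 2);
  (598841, 2, 1361); (652321, 7, 2); (668513, 3, 2); (695377, 5, 2);
  (1016929, 17, 2); (1017361, 13, 2); (1067851, 2, 113); (1161137, 3, 2);
  (1162529, 3, 2); (1202849, 3, 2); (1299437, 3, 163); (1316621, 2, 65831);
  (1408349, 3, 17); (1486321, 13, 2); (1534153, 3, 97); (1567661, 3, 103);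
  (1836959, 2, 48341); (2169031, 2, 17); (2264737, 5, 2); (2384497, 5, 2);
  (2417377, 5, 2); (2426269, 3, 103); (3275213, 3, 433); (3593669, 2, 69109);
  (3673919, 2, 1836959); (3685441, 13, 2); (4496497, 5, 2); (5376577, 5, 2);
  (5575597, 3, 103); (5702297, 3, 443); (5734021, 3, 227); (5796361, 5, 3);
  (8392897, 5, 2); (13063537, 5, 2); (15358129, 7, 2); (19362029, 3, 433);
  (19936481, 3, 2); (23492723, 2, 1067851); (25212001, 7, 2);
  (26709757, 3, 1097); (28914449, 3, 2); (33584561, 3, 2); (36302737, 5, 2);
  (37613869, 3, 4421); (40271681, 3, 2); (45092093, 3, 17); (46229089, 17, 2);
  (46433801, 3, 17); (46948081, 7, 2); (52864459, 2, 17); (70359721, 3, 1283);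
  (75005713, 5, 2); (85967393, 3, 2); (86896987, 2, 1316621); (101884753, 5, 2);
  (107367629, 3, 113); (108077329, 7, 2); (111177349, 3, 17);
  (111650629, 3, 17); (111869377, 5, 2); (127015129, 3, 3); (127489793, 3, 2);
  (127620817, 5, 2); (148587949, 3, 953); (169664753, 3, 2); (180201997, 7, 3);
  (180361969, 11, 2); (189513197, 3, 137); (260683037, 3, 239);
  (268321681, 7, 2); (269665073, 3, 2); (338218193, 3, 2);
  (347587949, 2, 86896987); (494425777, 5, 2); (671216263, 2, 111869377);
  (993140321, 3, 2); (1020601997, 2, 3593669); (1079423677, 3, 152203);
  (1262030333, 3, 128203); (1649929681, 29, 2); (1949940913, 5, 2);
  (2114608543, 2, 1202849); (2559066073, 3, 83761); (2748917329, 13, 2);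
  (2992293649, 13, 2); (3276805409, 3, 2); (3763867733, 3, 113);
  (4169564989, 2, 131267); (4884847621, 3, 113); (6923494537, 3, 23509);
  (9491060093, 3, 23492723); (9711451697, 3, 2); (15472037821, 3, 1153);
  (19949230201, 3, 353); (21685865473, 5, 2); (22696239091, 2, 108077329);
  (23233706849, 3, 2); (28136152951, 2, 409); (31463442317, 3, 3673919);
  (46354659937, 5, 2); (51861618869, 3, 65393); (53350902641, 3, 2);
  (87846225953, 3, 2); (221157147961, 7, 3); (244090948961, 3, 2);
  (250739578049, 3, 2); (272492464241, 3, 2); (350862114989, 3, 2264737);
  (379808347181, 3, 307); (409199473997, 3, 46948081); (685481530081, 7, 2);
  (734375121419, 2, 17); (962001652093, 3, 17); (1131019499249, 3, 2);
  (1230855683509, 2, 2169031); (2434616217281, 3, 2); (5415624023749, 3, 17);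
  (5998435712461, 3, 257); (6415042872829, 2, 28136152951);
  (7486076105281, 13, 2); (7535768054561, 3, 2);
  (10523982032237, 3, 4169564989); (12895071553121, 3, 2);
  (22810159626697, 3, 17); (25479896548961, 3, 2);
  (25726327534139, 2, 2114608543); (37636045604617, 3, 993140321);
  (50493458584097, 3, 2); (69241721884469, 3, 1020601997);
  (178925762979037, 3, 347587949); (190937531568941, 2, 734375121419);
  (261508343832349, 3, 17); (538742336469269, 2, 671216263);
  (762355930500341, 3, 17); (1026196240770781, 3, 443);
  (1842150665843953, 5, 2); (2154144916285781, 3, 17); (2322817005065617, 5, 2);
  (4382669950152869, 3, 53350902641); (6996402304983061, 3, 137);
  (8684496096371153, 3, 2); (12782703425963929, 3, 22696239091);
  (17931298197670721, 3, 2); (52484608344350561, 3, 2);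
  (58644340746226489, 3, 28914449); (128683108339978433, 3, 2);
  (142066482414807053, 3, 17); (171028625446956073, 3, 25726327534139);
  (480170172376488257, 3, 2); (603008777268061313, 3, 2);
  (920793289987614829, 3, 1230855683509);
  (1364821475654790269, 3, 190937531568941); (2087496636113790049, 13, 2);
  (2099331561841897633, 5, 2); (3548134348647175477, 3, 244090948961);
  (4307187407911389401, 3, 17); (5847108385182099701, 3, 881);
  (8572908156604109897, 3, 1697); (61373483330882447489, 3, 2);
  (236363502763835326909, 3, 538742336469269);
  (252587078442657646537, 3, 6415042872829); (416115013830990336221, 3, 6257);
  (5160866164857057845681, 3, 2); (11771688183089265130373, 3, 5101);
  (272281016544617157364597, 3, 25873); (604462909806215075725313, 3, 2);
  (26271537357151066722738558929, 3, 2);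
  (12195249347332865857250224356329, 3, 598841);
  (17840874019754397127034343123344273, 3, 2);
  (28560168011064685473913587072588901, 13, 3);
  (35568209416658236003782498459516841, 3, 52864459)]%num.

Definition certified := [seq cert.1.1 | cert <- certificates].

Definition non_higgs_divisors : seq N := [::
  17; 97; 103; 113; 137; 163; 193; 227; 239; 241; 257; 307; 337; 353; 389; 401;
  409; 433; 443; 449; 479; 487; 577; 593; 613; 619; 641; 647; 653; 673; 769;
  773; 811; 823; 1531; 1543; 1553; 1583; 1601; 1621; 1637; 1667; 1697; 1733;
  1747; 1777; 1783; 1871; 1873; 1889; 1907; 1913; 1931; 1949; 1973; 2017; 2063;
  2081; 2113; 2129; 2143; 2161; 2267; 2269; 2273; 2309; 2347; 2381; 2411; 2417;
  2459; 2467; 2473; 2477]%num.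

(** Pairs [(d, n)] with [n] a factor of [4 ^ d + 1]. A small [d] serves all its
    odd multiples; most primes [d] in the range need a pair of their own. *)
Definition factors : seq (N * N) := [::
  (7, 113); (11, 2113); (19, 525313); (25, 8101); (27, 246241); (29, 107367629);
  (37, 593); (39, 1249); (43, 500177); (45, 54001); (47, 3761); (53, 15358129);
  (59, 157649); (67, 2559066073); (69, 5415624023749); (71, 148587949);
  (73, 9929); (79, 604462909806215075725313); (83, 13063537); (101, 9491060093);
  (127, 26417); (131, 269665073); (139, 1408349); (167, 75005713);
  (169, 180201997); (179, 416115013830990336221); (181, 178925762979037);
  (191, 25212001); (269, 8609); (311, 21149); (313, 42569); (321, 1016929);
  (327, 5233); (331, 51861618869); (347, 5575597); (359, 585889);
  (373, 6996402304983061); (383, 111650629); (397, 25409); (403, 25793);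
  (419, 53633); (431, 12895071553121); (439, 695377); (461, 14753);
  (503, 350862114989); (519, 41521); (521, 16673); (523, 8369);
  (557, 142066482414807053); (569, 257189); (587, 2434616217281);
  (617, 2322817005065617); (631, 10523982032237); (669, 454921);
  (677, 480170172376488257); (687, 10993); (691, 11057); (743, 260683037);
  (757, 12782703425963929); (761, 1567661); (797, 1131019499249); (809, 25889);
  (827, 50493458584097); (831, 171028625446956073); (1511, 1026196240770781);
  (1523, 17840874019754397127034343123344273); (1527, 103837);
  (1549, 5847108385182099701); (1559, 3548134348647175477); (1567, 75217);
  (1571, 127489793); (1579, 37636045604617); (1585, 40271681); (1597, 19362029);
  (1607, 668513); (1609, 5702297); (1613, 5160866164857057845681);
  (1619, 8392897); (1623, 25969); (1627, 494425777); (1641, 288817);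
  (1657, 26513); (1663, 266081); (1669, 603008777268061313);
  (1681, 7486076105281); (1689, 1486321); (1693, 2748917329);
  (1709, 35568209416658236003782498459516841); (1713, 2384497);
  (1721, 85967393); (1723, 2099331561841897633); (1741, 236363502763835326909);
  (1745, 3685441); (1753, 6923494537); (1773, 1079423677);
  (1787, 1364821475654790269); (1789, 5796361); (1791, 121789); (1797, 28753);
  (1801, 23233706849); (1803, 58644340746226489); (1811, 8684496096371153);
  (1821, 29137); (1823, 58337); (1831, 46229089); (1835, 4307187407911389401);
  (1847, 88657); (1861, 1949940913); (1867, 4382669950152869);
  (1877, 22810159626697); (1879, 762355930500341); (1891, 3275213);
  (1895, 17931298197670721); (1899, 387397); (1901, 4884847621); (1929, 308641);
  (1933, 12195249347332865857250224356329); (1937, 2417377); (1951, 46433801);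
  (1963, 2426269); (1977, 1534153); (1979, 252587078442657646537);
  (1983, 126913); (1987, 272281016544617157364597); (1993, 1299437);
  (1997, 3276805409); (1999, 189513197); (2003, 250739578049);
  (2011, 920793289987614829); (2027, 261508343832349); (2029, 26709757);
  (2039, 101884753); (2041, 338218193); (2047, 61373483330882447489);
  (2049, 5376577); (2053, 45092093); (2069, 221157147961); (2087, 169664753);
  (2089, 11771688183089265130373); (2097, 21685865473); (2099, 9711451697);
  (2103, 1649929681); (2105, 5734021); (2111, 1842150665843953);
  (2127, 37613869); (2131, 33584561); (2137, 1162529); (2141, 31463442317);
  (2153, 272492464241); (2157, 19949230201); (2179, 409199473997);
  (2181, 46354659937); (2199, 2992293649); (2203, 379808347181);
  (2207, 5998435712461); (2213, 685481530081); (2217, 390193); (2221, 35537);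
  (2235, 15472037821); (2237, 393713); (2239, 52484608344350561); (2243, 71777);
  (2249, 539761); (2253, 127015129); (2259, 243973); (2265, 652321);
  (2281, 26271537357151066722738558929); (2285, 70359721); (2287, 180361969);
  (2293, 962001652093); (2297, 2087496636113790049); (2315, 111121);
  (2333, 7535768054561); (2335, 37361); (2339, 111177349); (2341, 1161137);
  (2351, 19936481); (2355, 1017361); (2357, 8572908156604109897);
  (2361, 36302737); (2367, 426061); (2371, 493169); (2377, 128683108339978433);
  (2383, 25479896548961); (2389, 2154144916285781); (2393, 87846225953);
  (2399, 115153); (2423, 69241721884469); (2437, 127620817); (2439, 78049);
  (2441, 28560168011064685473913587072588901); (2447, 3763867733);
  (2455, 268321681); (2461, 1262030333); (2463, 39409); (2487, 4496497);
  (2495, 79841)]%num.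

Definition divisor_ok (r : N) : bool :=
  [&& has (N.eqb r) certified, 1 <? r, r mod 2 =? 1
    & ~~ (powmod 4 25 r =? 24)]%num.

Definition factor_ok (dn : N * N) : bool :=
  let: (d, n) := dn in
  [&& has (N.eqb n) certified, 1 <? n & powmod 4 n d =? n - 1]%num.

Definition obstructions : seq N := non_higgs_divisors ++ map fst factors.

Lemma certificates_ok : all_certified [::] certificates.
Proof. by vm_compute. Qed.

Lemma divisors_ok : all divisor_ok non_higgs_divisors.
Proof. by vm_compute. Qed.

Lemma factors_ok : all factor_ok factors.
Proof. by vm_compute. Qed.

Lemma certified_higgs_free n : has (N.eqb n) certified ->
  higgs_free (N.to_nat n).
Proof. exact: all_certifiedP certificates_ok n. Qed.

(** Stated with the numeral [4] in [nat], so that rewriting with [powmodE] never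
   asks for the conversion of a power of [N.to_nat 4]. *)
Lemma powmod4E n d : N.to_nat (powmod 4 n d) = 4 ^ N.to_nat d %% N.to_nat n.
Proof. exact: powmodE. Qed.

Lemma obstructionsP d :
  d \in map N.to_nat obstructions -> obstruction d.
Proof.
rewrite map_cat mem_cat -map_comp => /orP[].
  case/mapP=> r /(allP divisors_ok)/and4P[r_cert r_gt1 r_odd not24] ->.
  apply: non_higgs_divisor.
  - exact: certified_higgs_free.
  - exact: to_nat_gt1.
  - by move: r_odd; rewrite -to_nat_eq to_nat_mod modn2 eqb1.
  - move: not24; rewrite -to_nat_eq powmod4E; apply: contra_neqN.
    by rewrite -[N.to_nat 25]/25 -[N.to_nat 24]/24; lia.
case/mapP=> -[e n] /(allP factors_ok)/and3P[n_cert n_gt1 pow_eq] ->.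
exists (N.to_nat n); split.
- exact: to_nat_gt1.
- move: pow_eq; rewrite -to_nat_eq powmod4E to_natB /dvdn -modnDml => /eqP->.
  by rewrite subnK ?modnn // ltnW // to_nat_gt1.
- exact: certified_higgs_free.
Qed.

Lemma odd_exponents_covered :
  all (fun k => [|| ~~ odd k, k \in [:: 1699; 1759; 2083; 2251; 2311]
      | let k_N := N.of_nat k in has (fun d => k_N mod d =? 0)%num obstructions])
    (iota 1501 1000).
Proof. by vm_compute. Qed.

Theorem theorem11 :
  forall m : nat, H_even m -> 3000 < m <= 5000 ->
    m \in [:: 3398; 3518; 4166; 4502; 4622].
Proof.
move=> m [mH m_even] /andP[m_gt m_le].
have m_gt0 : 0 < m by exact: leq_ltn_trans m_gt.
have [k def_m] := dvdnP m_even.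
have k_odd : odd k.
  apply/negPn/negP=> k_even; apply: (dvdn4_not_H m) mH => //.
  by rewrite def_m -[4]/(2 * 2) dvdn_pmul2r // dvdn2.
have k_in : k \in iota 1501 1000.
  by move: m_gt m_le; rewrite mem_iota def_m; clear; lia.
have := allP odd_exponents_covered k k_in.
rewrite k_odd orFb => /orP[k_exc | has_d]; last first.
  have [d d_in] := @hasP N _ _ has_d.
  rewrite -to_nat_eq to_nat_mod Nat2N.id => d_dvd_k.
  have [n [n_gt1 n_dvd n_free]] := obstructionsP _ (map_f N.to_nat d_in).
  case: (dvdn_not_H m n n_gt1 _ n_free mH).
  by rewrite def_m mulnC expnM (dvdn_trans n_dvd) // dvdn_succ_4exp.
by move: k_exc; rewrite def_m !inE => /or4P[|||/orP[]]/eqP->.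
Qed.
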